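(* Let $A\in\mathbb C^{N\times N}$. Then the set $\mathbf G_A^I$ of graphs isomorphic to $\mathcal G(A)$ is an equivalence class with respect to invariance of the graph Fourier transform up to a permutation of the graph signal and inverse permutation of the transform. That is: graph isomorphism is an equivalence relation on graphs with adjacency matrices in $\mathbb C^{N\times N}$, $\mathbf G_A^I$ is the class of $\mathcal G(A)$, and for any $\mathcal G(B),\mathcal G(C)\in\mathbf G_A^I$ there is a permutation matrix $T$ with $C=TBT^{-1}$ such that, with eigenvector matrices related by $V_C=TV_B$, for every $s\in\mathbb C^N$ and all $i,j$ the graph Fourier transform components satisfy $\widehat s_{B,ij}=T^{-1}\,\widehat{(Ts)}_{C,ij}$.
   Context: $\mathcal G(A)$ is the (weighted, directed) graph with adjacency matrix $A\in\mathbb C^{N\times N}$. Let $A$ have distinct eigenvalues $\lambda_1,\dots,\lambda_k$ with geometric multiplicities $g_1,\dots,g_k$. A Jordan decomposition is $A=VJV^{-1}$, where $J$ is block diagonal with upper triangular Jordan blocks of size $r_{ij}$ for $\lambda_i$ ($i=1,\dots,k$, $j=1,\dots,g_i$) and $V=[V_{11}\cdots V_{1g_1}\cdots V_{k1}\cdots V_{kg_k}]$ is partitioned conformally, $V_{ij}\in\mathbb C^{N\times r_{ij}}$ having as columns a Jordan chain of $\lambda_i$. The Jordan subspaces are $\mathscr J_{ij}=\mathrm{span}\{V_{ij}\}$ (column span), and $\mathbb C^N=\bigoplus_{i,j}\mathscr J_{ij}$. Graph Fourier transform (GFT) of $s\in\mathbb C^N$ over $\mathcal G(A)$ (with the given decomposition):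 the tuple $(\widehat s_{A,ij})_{i,j}$ of the unique vectors $\widehat s_{A,ij}\in\mathscr J_{ij}$ with $s=\sum_{i,j}\widehat s_{A,ij}$. Two graphs $\mathcal G(A),\mathcal G(B)$ are isomorphic if $B=TAT^{-1}$ for a permutation matrix $T$; in that case eigenvector matrices are taken to be related by $V_B=TV_A$ (with the same Jordan form $J$). *)

(* Defs.v *)
From HB Require Import structures.
From mathcomp Require Import all_boot all_order all_algebra.
From mathcomp Require Import boolp classical_sets reals.
From mathcomp Require Export complex.
From Corelib Require Classes.RelationClasses.

Set Implicit Arguments.
Unset Strict Implicit.
Unset Printing Implicit Defensive.

Import GRing.Theory.
Local Open Scope ring_scope.

(* A weighted directed graph on N nodes is determined by its adjacency matrix;
   [Graph A] is G(A). *)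
Record graph (F : fieldType) (N : nat) := Graph { adjmx : 'M[F]_N }.

Definition graph_iso (F : fieldType) (N : nat) (G H : graph F N) : Prop :=
  exists2 T : 'M[F]_N, is_perm_mx T & adjmx H = T *m adjmx G *m invmx T.

Definition iso_class (F : fieldType) (N : nat) (A : 'M[F]_N) :
  set (graph F N) := [set H | graph_iso (Graph A) H]%classic.

Definition jordan_block (F : fieldType) (a : F) (n : nat) : 'M[F]_n :=
  \matrix_(p, q) (a *+ (p == q) + (p.+1 == q)%:R).

(* The data of a Jordan normal form: k distinct scalars, and for the i-th one
   g_i blocks of positive sizes r_ij. *)
Record jordan_form (F : fieldType) := JordanForm {
  jf_k : nat;
  jf_lambda : 'I_jf_k -> F;
  jf_g : 'I_jf_k -> nat;
  jf_r : forall i : 'I_jf_k, 'I_(jf_g i) -> nat;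
  jf_lambda_inj : injective jf_lambda;
  jf_r_gt0 : forall (i : 'I_jf_k) (j : 'I_(jf_g i)), (0 < jf_r j)%N
}.
Arguments jf_lambda {F} J i : rename.
Arguments jf_g {F} J i : rename.
Arguments jf_r {F} J i j : rename.

Definition jordan_dim (F : fieldType) (J : jordan_form F) : nat :=
  (\sum_(i < jf_k J) \sum_(j < jf_g J i) jf_r J i j)%N.

Definition jordan_mx (F : fieldType) (J : jordan_form F) :
    'M[F]_(jordan_dim J) :=
  \mxdiag_(i < jf_k J) \mxdiag_(j < jf_g J i)
    jordan_block (jf_lambda J i) (jf_r J i j).

Definition chain_family (F : fieldType) (N : nat) (J : jordan_form F) :=
  forall (i : 'I_(jf_k J)) (j : 'I_(jf_g J i)), 'M[F]_(N, jf_r J i j).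

Definition chain_mx (F : fieldType) (N : nat) (J : jordan_form F)
    (V : chain_family N J) : 'M[F]_(N, jordan_dim J) :=
  \mxrow_(i < jf_k J) \mxrow_(j < jf_g J i) V i j.

(* A = V J V^-1.  The width of V is N only propositionally, so invertibility
   of V is expressed by a two-sided inverse W, which forces N = jordan_dim J.
   MathComp's [eigenvalue] and [eigenspace] concern row vectors, hence the
   transposes. *)
Record jordan_decomposition (F : fieldType) (N : nat) (A : 'M[F]_N)
    (J : jordan_form F) := JordanDecomposition {
  jd_V : chain_family N J;
  jd_eigenvalues :
    forall a : F, eigenvalue A^T a <-> exists i, jf_lambda J i = a;
  jd_geometric_multiplicity :
    forall i, jf_g J i = \rank (eigenspace A^T (jf_lambda J i));
  jd_factorization : exists W : 'M[F]_(jordan_dim J, N),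
    [/\ chain_mx jd_V *m W = 1%:M,
        W *m chain_mx jd_V = 1%:M
      & A = chain_mx jd_V *m jordan_mx J *m W]
}.
Arguments jd_V {F N A J} D i j : rename.

Definition eigenvector_mx (F : fieldType) (N : nat) (A : 'M[F]_N)
    (J : jordan_form F) (D : jordan_decomposition A J) :
    'M[F]_(N, jordan_dim J) := chain_mx (jd_V D).

Definition jordan_subspace (F : fieldType) (N : nat) (A : 'M[F]_N)
    (J : jordan_form F) (D : jordan_decomposition A J)
    (i : 'I_(jf_k J)) (j : 'I_(jf_g J i)) : {vspace 'cV[F]_N} :=
  <<[seq col c (jd_V D i j) | c : 'I_(jf_r J i j)]>>%VS.
Arguments jordan_subspace {F N A J} D i j.

Definition is_gft (F : fieldType) (N : nat) (A : 'M[F]_N)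
    (J : jordan_form F) (D : jordan_decomposition A J) (s : 'cV[F]_N)
    (shat : forall i : 'I_(jf_k J), 'I_(jf_g J i) -> 'cV[F]_N) : Prop :=
  (forall i (j : 'I_(jf_g J i)), shat i j \in jordan_subspace D i j) /\
  s = \sum_(i < jf_k J) \sum_(j < jf_g J i) shat i j.

Section Gft.
Variables (F : fieldType) (N : nat) (A : 'M[F]_N) (J : jordan_form F).
Variable D : jordan_decomposition A J.

Lemma mem_jordan_subspace (i : 'I_(jf_k J)) (j : 'I_(jf_g J i)) (v : 'cV[F]_N) :
  v \in jordan_subspace D i j <-> exists c, v = jd_V D i j *m c.
Proof.
have mulE c : jd_V D i j *m c = \sum_k c k 0 *: col k (jd_V D i j).
  apply/matrixP => p q; rewrite !mxE summxE; apply: eq_bigr => k _.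
  by rewrite !mxE mulrC (ord1 q).
split=> [|[c ->]]; last first.
  rewrite mulE; apply: memv_suml => k _; apply: memvZ.
  by apply: memv_span; apply/mapP; exists k; rewrite ?mem_enum.
rewrite /jordan_subspace span_def big_map big_enum.
case/memv_sumP => vs vsP ->.
have /(_ _)/cid h k : exists a, vs k = a *: col k (jd_V D i j).
  by case/vlineP: (vsP k isT) => a ->; exists a.
exists (\col_k projT1 (h k)); rewrite mulE; apply: eq_bigr => k _.
by rewrite mxE -(projT2 (h k)).
Qed.

Lemma chain_mx_mul (c : forall i (j : 'I_(jf_g J i)), 'cV[F]_(jf_r J i j)) :
  \sum_i \sum_j jd_V D i j *m c i j =
  eigenvector_mx D *m (\mxcol_i \mxcol_j c i j).
Proof.
rewrite /eigenvector_mx /chain_mx mul_mxrow_mxcol; apply: eq_bigr => i _.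
by rewrite mul_mxrow_mxcol.
Qed.

Lemma gft_exists (s : 'cV[F]_N) : exists shat, is_gft D s shat.
Proof.
have [W [VW _ _]] := jd_factorization D.
exists (fun i j => jd_V D i j *m submxcol (submxcol (W *m s) i) j); split.
  by move=> i j; apply/mem_jordan_subspace; eexists.
rewrite (chain_mx_mul (fun i j => submxcol (submxcol (W *m s) i) j)).
rewrite (_ : \mxcol_i _ = W *m s) ?mulmxA ?VW ?mul1mx //.
by under eq_mxcol do rewrite submxcolK; rewrite submxcolK.
Qed.

Lemma gft_unique (s : 'cV[F]_N) shat1 shat2 :
  is_gft D s shat1 -> is_gft D s shat2 ->
  forall i (j : 'I_(jf_g J i)), shat1 i j = shat2 i j.
Proof.
move=> [m1 e1] [m2 e2] i0 j0; have [W [_ WV _]] := jd_factorization D.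
have /(_ _ _)/cid h1 i j := (mem_jordan_subspace _ _).1 (m1 i j).
have /(_ _ _)/cid h2 i j := (mem_jordan_subspace _ _).1 (m2 i j).
pose c1 i j := projT1 (h1 i j); pose c2 i j := projT1 (h2 i j).
have E1 i j : shat1 i j = jd_V D i j *m c1 i j := projT2 (h1 i j).
have E2 i j : shat2 i j = jd_V D i j *m c2 i j := projT2 (h2 i j).
have : \mxcol_i \mxcol_j c1 i j = \mxcol_i \mxcol_j c2 i j.
  rewrite -[LHS]mul1mx -[RHS]mul1mx -WV -!mulmxA; congr (_ *m _).
  rewrite -/(eigenvector_mx D) -!chain_mx_mul.
  transitivity s; [rewrite e1 | rewrite e2];
    by apply: eq_bigr => i _; apply: eq_bigr => j _; rewrite ?E1 ?E2.
by move=> /eq_mxcolP/(_ i0)/eq_mxcolP/(_ j0) e; rewrite E1 E2 e.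
Qed.

(* The tuple singled out by [is_gft]: see [gftP] and [gft_unique]. *)
Definition gft (s : 'cV[F]_N) :
    forall i : 'I_(jf_k J), 'I_(jf_g J i) -> 'cV[F]_N :=
  projT1 (cid (gft_exists s)).

Lemma gftP (s : 'cV[F]_N) : is_gft D s (gft s).
Proof. exact: projT2 (cid (gft_exists s)). Qed.

End Gft.
Arguments gft {F N A J} D s i j.

(* Main.v *)
(* If B = V J W with W = V^-1 and C = T B T^-1, then C = (TV) J (W T^-1), so T
   carries the Jordan subspaces of B onto those of C.  Applying T^-1 to the
   decomposition of Ts therefore decomposes s along the Jordan subspaces of B,
   and such a decomposition is unique. *)
Require Import Defs.
From mathcomp Require Import all_boot all_order all_algebra.
From mathcomp Require Import fingroup perm.
From mathcomp Require Import boolp classical_sets reals.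

Set Implicit Arguments.
Unset Strict Implicit.
Unset Printing Implicit Defensive.

Local Open Scope ring_scope.

Lemma invmx_unique (F : fieldType) (N : nat) (A B : 'M[F]_N) :
  A *m B = 1%:M -> invmx A = B.
Proof.
by move=> AB; have [Au _] := mulmx1_unit AB; rewrite -[RHS](mulKmx Au) AB mulmx1.
Qed.

Lemma conj_mx_sym (F : fieldType) (N : nat) (T A B : 'M[F]_N) :
  T \in unitmx -> B = T *m A *m invmx T -> A = invmx T *m B *m invmx (invmx T).
Proof. by move=> Tu ->; rewrite invmxK !mulmxA mulVmx // mul1mx mulmxKV. Qed.

Lemma graph_iso_equiv (F : fieldType) (N : nat) :
  RelationClasses.Equivalence (@graph_iso F N).
Proof.
split=> [G|G H [_ /is_perm_mxP [u ->] defH]|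
         G H K [_ /is_perm_mxP [u ->] defH] [_ /is_perm_mxP [v ->] defK]].
- by exists 1%:M; rewrite ?is_perm_mx1 // invmx1 mul1mx mulmx1.
- exists (invmx (perm_mx u)).
    (* The inverse of a permutation matrix is again one, namely that of [u^-1]. *)
    rewrite (@invmx_unique _ _ _ (perm_mx u^-1)) ?perm_mx_is_perm //.
    by rewrite -perm_mxM mulgV perm_mx1.
  exact: conj_mx_sym (unitmx_perm _ _) defH.
exists (perm_mx v *m perm_mx u).
  by rewrite -perm_mxM perm_mx_is_perm.
rewrite (@invmx_unique _ _ _ (invmx (perm_mx u) *m invmx (perm_mx v))).
  by rewrite defK defH !mulmxA.
by rewrite mulmxA mulmxK ?mulmxV ?unitmx_perm.
Qed.

Section Conjugation.
Variables (F : fieldType) (N : nat) (T B C : 'M[F]_N).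
Hypotheses (Tu : T \in unitmx) (defC : C = T *m B *m invmx T).

(** Transposing turns conjugation by [T] into conjugation by the inverse of [T^T], and invertible
    factors on either side preserve the rank of [B^T - a%:M], hence the dimension of its kernel.
    This transports both the spectrum and the geometric multiplicities from [B] to [C]. *)
Lemma rank_eigenspace_tr_conj (a : F) :
  \rank (eigenspace C^T a) = \rank (eigenspace B^T a).
Proof.
rewrite !mxrank_ker; congr (_ - _)%N.
have -> : C^T - a%:M = invmx T^T *m (B^T - a%:M) *m T^T.
  rewrite mulmxBr mulmxBl mul_mx_scalar -scalemxAl mulVmx ?unitmx_tr //.
  by rewrite scalemx1 defC !trmx_mul trmx_inv mulmxA.
rewrite mxrankMfree ?row_free_unit ?unitmx_tr //.
by rewrite eqmxMfull // row_full_unit unitmx_inv unitmx_tr.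
Qed.

Lemma eigenvalue_tr_conj (a : F) : eigenvalue C^T a = eigenvalue B^T a.
Proof. by rewrite /eigenvalue -!mxrank_eq0 rank_eigenspace_tr_conj. Qed.

Lemma chain_mx_mull (J : jordan_form F) (V : chain_family N J) :
  chain_mx (fun i j => T *m V i j) = T *m chain_mx V.
Proof.
by rewrite /chain_mx mul_mxrow; apply: eq_mxrow => i; rewrite mul_mxrow.
Qed.

Variable J : jordan_form F.

Lemma jordan_decomposition_conj (DB : jordan_decomposition B J) :
  exists DC : jordan_decomposition C J,
    eigenvector_mx DC = T *m eigenvector_mx DB.
Proof.
have lamC a : eigenvalue C^T a <-> exists i, jf_lambda J i = a.
  by rewrite eigenvalue_tr_conj; exact: jd_eigenvalues DB a.
have gC i : jf_g J i = \rank (eigenspace C^T (jf_lambda J i)).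
  by rewrite rank_eigenspace_tr_conj; exact: jd_geometric_multiplicity DB i.
have facC : exists W : 'M[F]_(jordan_dim J, N),
    [/\ chain_mx (fun i j => T *m jd_V DB i j) *m W = 1%:M,
        W *m chain_mx (fun i j => T *m jd_V DB i j) = 1%:M
      & C = chain_mx (fun i j => T *m jd_V DB i j) *m jordan_mx J *m W].
  have [W [VW WV defB]] := jd_factorization DB.
  (* The chains [T *m V] have the inverse [W *m invmx T], since [W] inverts [V]. *)
  exists (W *m invmx T); rewrite chain_mx_mull; split.
  - by rewrite mulmxA -(mulmxA T) VW mulmx1 mulmxV.
  - by rewrite mulmxA mulmxKV.
  - by rewrite defC {1}defB !mulmxA.
by exists (JordanDecomposition lamC gC facC); exact: chain_mx_mull.
Qed.

Lemma gft_conj (DB : jordan_decomposition B J) (DC : jordan_decomposition C J) :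
  eigenvector_mx DC = T *m eigenvector_mx DB ->
  forall (s : 'cV[F]_N) (i : 'I_(jf_k J)) (j : 'I_(jf_g J i)),
    gft DB s i j = invmx T *m gft DC (T *m s) i j.
Proof.
rewrite /eigenvector_mx -chain_mx_mull /chain_mx => /eq_mxrowP eqV s.
(* Both chain matrices are partitioned by the same [J], so their equality splits into one equality
   per block. *)
have {}eqV i j : jd_V DC i j = T *m jd_V DB i j.
  by move/eq_mxrowP: (eqV i).
have [memC sumC] := gftP DC (T *m s).
apply: (gft_unique (gftP DB s)); split=> [i j|].
  (* The coefficient vector [c] carries over unchanged: [T] cancels from
     [invmx T *m (T *m V *m c)]. *)
  have [c ->] := (mem_jordan_subspace DC j _).1 (memC i j).
  by apply/mem_jordan_subspace; exists c; rewrite eqV -mulmxA mulKmx.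
under eq_bigr do rewrite -mulmx_sumr.
by rewrite -mulmx_sumr -sumC mulKmx.
Qed.

End Conjugation.

Theorem theorem2 (R : realType) (N : nat) (A : 'M[R[i]]_N) :
  [/\ RelationClasses.Equivalence (@graph_iso R[i] N),
      iso_class A (Graph A),
      (forall G H : graph R[i] N,
         iso_class A G -> (iso_class A H <-> graph_iso G H))
    & forall B C : 'M[R[i]]_N,
        iso_class A (Graph B) -> iso_class A (Graph C) ->
        exists T : 'M[R[i]]_N,
          [/\ is_perm_mx T,
              C = T *m B *m invmx T
            & forall (J : jordan_form R[i]) (DB : jordan_decomposition B J),
                (exists DC : jordan_decomposition C J,
                   eigenvector_mx DC = T *m eigenvector_mx DB) /\
                (forall DC : jordan_decomposition C J,
                   eigenvector_mx DC = T *m eigenvector_mx DB ->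
                   forall (s : 'cV[R[i]]_N)
                          (i : 'I_(jf_k J)) (j : 'I_(jf_g J i)),
                     gft DB s i j = invmx T *m gft DC (T *m s) i j)]].
Proof.
have [refl sym trans] := @graph_iso_equiv R[i] N.
split=> [||G H AG|B C AB AC]; first exact: graph_iso_equiv.
- exact: refl.
- split=> [AH|GH]; last exact: trans AG GH.
  exact: trans (sym _ _ AG) AH.
(* Going from [B] back to [A] and on to [C] gives a [T] fixed before [J] and [DB], so one
   permutation serves every Jordan decomposition of [B]. *)
have [T permT defC] := trans _ _ _ (sym _ _ AB) AC.
exists T; split=> // J DB.
have Tu : T \in unitmx by case/is_perm_mxP: permT => u ->; exact: unitmx_perm.
split; first exact: jordan_decomposition_conj.
exact: gft_conj.
Qed.
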